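(* Let $1\le d<n$ and let $F=(f_1,\dots,f_{n-d})$ be a system of real polynomials in $z_1,\dots,z_n$ whose real zero set $X=\mathcal V(f_1,\dots,f_{n-d})\subset\mathbb R^n$ is a smooth pure $d$-dimensional variety. Let $\hat z\in\mathbb R^n$, let $r=(r_1,r_2)$ be a pair of positive numbers, and let $A$ be an invertible $(n-d)\times(n-d)$ real matrix. Put $I=\pi_d(\hat z)+r_1[-1,1]^d\subseteq\mathbb R^d$ and $J=\pi_{-d}(\hat z)+r_2[-1,1]^{n-d}\subseteq\mathbb R^{n-d}$, and let $$K(F,\hat z,r,A)=-A\,\square F(I,\pi_{-d}(\hat z))+\bigl(Id_{n-d}-A\,\square J_F(I,J)\bigr)\bigl(J-\pi_{-d}(\hat z)\bigr).$$ If there exists $\rho\in(0,1)$ with $$K(F,\hat z,r,A)\subset\rho\,(J-\pi_{-d}(\hat z)),$$ then for every $\hat x\in I$ there exists a unique $y^*\in J$ such that $F(\hat x,y^* )=0$, and it satisfies $\|y^*-\pi_{-d}(\hat z)\|\le r_2\rho$.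
   Context: $\pi_d:\mathbb R^n\to\mathbb R^d$ is the projection onto the first $d$ coordinates and $\pi_{-d}:\mathbb R^n\to\mathbb R^{n-d}$ the projection onto the last $n-d$ coordinates. $Id_{n-d}$ is the identity matrix of size $n-d$. Interval arithmetic: for an arithmetic operation $\odot$ and compact intervals $P,Q$, $P\odot Q=\{p\odot q: p\in P,\ q\in Q\}$. Sums and products of interval matrices and interval vectors (boxes) are formed by the usual matrix formulas, with every entrywise operation being an interval operation; real numbers are identified with degenerate intervals. A box is a product of compact intervals. For $f:\mathbb R^m\to\mathbb R$, an interval extension $\square f$ of $f$ is any function from boxes to compact intervals with $\square f(P)\supseteq\{f(x):x\in P\}$ for every box $P$. An interval extension of a system (or of a matrix of functions) consists of interval extensions of its entries. $\square F(I,\pi_{-d}(\hat z))$ is an interval extension of $F$ evaluated on $I\times\{\pi_{-d}(\hat z)\}$. $\square J_F(I,J)$ is an interval extension, evaluated on $I\times J$, of the $(n-d)\times(n-d)$ Jacobian submatrix $\left[\frac{\partial f_i}{\partial z_j}\right]_{1\le i\le n-d,\ d+1\le j\le n}$. $\|\cdot\|$ is the maximum norm on $\mathbb R^{n-d}$. *)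

(* Defs.v *)
From HB Require Import structures.
From mathcomp Require Import all_boot all_order all_algebra.
(* Not imported: the notations of mpoly clash with those of the analysis
   library. *)
From mathcomp Require mpoly.
From mathcomp Require Import boolp classical_sets set_interval reals.
From mathcomp Require Import topology normedtype.

Set Implicit Arguments.
Unset Strict Implicit.
Unset Printing Implicit Defensive.

Import Order.TTheory GRing.Theory Num.Theory.
Import numFieldNormedType.Exports.

Local Open Scope classical_set_scope.
Local Open Scope ring_scope.

(* Real polynomials in z_1, ..., z_n as functions on R^n. *)

Definition peval (R : realType) (n : nat) (p : mpoly.mpoly n R)
  (z : 'cV[R]_n) : R := mpoly.meval (fun i => z i 0) p.

Definition pderiv (R : realType) (n : nat) (i : 'I_n) (p : mpoly.mpoly n R) :
  mpoly.mpoly n R := mpoly.mderiv i p.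

(* Real algebraic sets, with irreducibility and dimension taken in the Zariski
   topology of R^n. *)

Section RealVarieties.
Variables (R : realType) (n : nat).
Implicit Types (S : set (mpoly.mpoly n R)) (X V Z : set 'cV[R]_n).

Definition zero_locus S : set 'cV[R]_n :=
  [set z | forall p, S p -> peval p z = 0].

Definition vanishing_ideal X : set (mpoly.mpoly n R) :=
  [set p | forall z, X z -> peval p z = 0].

Definition algebraic_set X : Prop := exists S, X = zero_locus S.

Definition irreducible_set Z : Prop :=
  [/\ algebraic_set Z, Z !=set0 &
      forall Y1 Y2, algebraic_set Y1 -> algebraic_set Y2 ->
        Z `<=` Y1 `|` Y2 -> Z `<=` Y1 \/ Z `<=` Y2].

Definition irreducible_component X Z : Prop :=
  [/\ irreducible_set Z, Z `<=` X &
      forall W, irreducible_set W -> Z `<=` W -> W `<=` X -> W = Z].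

Definition has_irreducible_chain V (k : nat) : Prop :=
  exists c : nat -> set 'cV[R]_n,
    (forall i, (i <= k)%N -> irreducible_set (c i) /\ c i `<=` V) /\
    (forall i, (i < k)%N -> c i `<` c i.+1).

Definition krull_dimension V (k : nat) : Prop :=
  has_irreducible_chain V k /\ ~ has_irreducible_chain V k.+1.

Definition pure_dimensional X (k : nat) : Prop :=
  forall Z, irreducible_component X Z -> krull_dimension Z k.

Definition tangent_space X (p : 'cV[R]_n) : set 'cV[R]_n :=
  [set v | forall g, vanishing_ideal X g ->
             \sum_(i < n) peval (pderiv i g) p * v i 0 = 0].

(* X is pure of dimension k and nonsingular at each of its points: the Zariski
   tangent space, which is computed from all the polynomials vanishing on X and
   not from a chosen system of equations, has dimension k. *)
Definition smooth_pure_variety X (k : nat) : Prop :=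
  [/\ algebraic_set X, pure_dimensional X k &
      forall p, X p -> exists T : {vspace 'cV[R]_n},
        (forall v, v \in T <-> tangent_space X p v) /\ \dim T = k].

End RealVarieties.

(* Intervals are represented by the sets of their points, interval matrices and
   interval vectors by matrices of such sets. *)

Section IntervalArithmetic.
Variable R : realType.
Implicit Types P Q : set R.

Definition compact_interval P : Prop :=
  exists a b : R, a <= b /\ P = `[a, b]%classic.

Definition iadd P Q : set R := [set p + q | p in P & q in Q].
Definition isub P Q : set R := [set p - q | p in P & q in Q].
Definition imul P Q : set R := [set p * q | p in P & q in Q].

Definition degenerate m k (M : 'M[R]_(m, k)) : 'M[set R]_(m, k) :=
  \matrix_(i, j) [set M i j].

Definition imx_add m k (P Q : 'M[set R]_(m, k)) : 'M[set R]_(m, k) :=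
  \matrix_(i, j) iadd (P i j) (Q i j).

Definition imx_sub m k (P Q : 'M[set R]_(m, k)) : 'M[set R]_(m, k) :=
  \matrix_(i, j) isub (P i j) (Q i j).

Definition imx_mul m k l (P : 'M[set R]_(m, k)) (Q : 'M[set R]_(k, l)) :
    'M[set R]_(m, l) :=
  \matrix_(i, j) \big[iadd/[set 0]]_(h < k) imul (P i h) (Q h j).

Definition imx_scale m k (a : R) (P : 'M[set R]_(m, k)) : 'M[set R]_(m, k) :=
  \matrix_(i, j) imul [set a] (P i j).

Definition is_box m (B : 'cV[set R]_m) : Prop :=
  forall i, compact_interval (B i 0).

Definition box_set m (B : 'cV[set R]_m) : set 'cV[R]_m :=
  [set x | forall i, B i 0 (x i 0)].

(* Only the values of [sf] on boxes are constrained and used. *)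
Definition interval_extension m (f : 'cV[R]_m -> R)
    (sf : 'cV[set R]_m -> set R) : Prop :=
  forall B, is_box B ->
    compact_interval (sf B) /\ f @` box_set B `<=` sf B.

(* a + r [-1, 1]^m *)
Definition centered_box m (a : 'cV[R]_m) (r : R) : 'cV[set R]_m :=
  imx_add (degenerate a) (imx_scale r (const_mx `[-1, 1]%classic)).

End IntervalArithmetic.

(* The splitting of R^n as R^d * R^(n - d), and of boxes accordingly. *)

Section Splitting.
Variables (n d : nat) (le_dn : (d <= n)%N).

Definition first_coords T (z : 'cV[T]_n) : 'cV[T]_d :=
  usubmx (castmx (esym (subnKC le_dn), erefl 1%N) z).

Definition last_coords T (z : 'cV[T]_n) : 'cV[T]_(n - d) :=
  dsubmx (castmx (esym (subnKC le_dn), erefl 1%N) z).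

Definition join_coords T (x : 'cV[T]_d) (y : 'cV[T]_(n - d)) : 'cV[T]_n :=
  castmx (subnKC le_dn, erefl 1%N) (col_mx x y).

Definition last_index (j : 'I_(n - d)) : 'I_n :=
  cast_ord (subnKC le_dn) (rshift d j).

End Splitting.

Section Krawczyk.
Variables (R : realType) (n d : nat) (le_dn : (d <= n)%N).

Definition system_extension (F : 'I_(n - d) -> mpoly.mpoly n R)
    (sF : 'I_(n - d) -> 'cV[set R]_n -> set R) : Prop :=
  forall i, interval_extension (peval (F i)) (sF i).

Definition jacobian_extension (F : 'I_(n - d) -> mpoly.mpoly n R)
    (sJ : 'I_(n - d) -> 'I_(n - d) -> 'cV[set R]_n -> set R) : Prop :=
  forall i j,
    interval_extension (peval (pderiv (last_index le_dn j) (F i))) (sJ i j).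

(* [sF] and [sJ] are the interval extensions of F and of the Jacobian block;
   K depends on F only through them. *)
Definition krawczyk (sF : 'I_(n - d) -> 'cV[set R]_n -> set R)
    (sJ : 'I_(n - d) -> 'I_(n - d) -> 'cV[set R]_n -> set R)
    (zhat : 'cV[R]_n) (r1 r2 : R) (A : 'M[R]_(n - d)) : 'cV[set R]_(n - d) :=
  let I := centered_box (first_coords le_dn zhat) r1 in
  let J := centered_box (last_coords le_dn zhat) r2 in
  let y0 := degenerate (last_coords le_dn zhat) in
  let sF_Iy0 := \col_i sF i (join_coords le_dn I y0) in
  let sJ_IJ := \matrix_(i, j) sJ i j (join_coords le_dn I J) in
  imx_add (imx_mul (degenerate (- A)) sF_Iy0)
          (imx_mul (imx_sub (degenerate 1%:M) (imx_mul (degenerate A) sJ_IJ))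
                   (imx_sub J y0)).

End Krawczyk.

(* Main.v *)
(* For x in I consider the Newton map y |-> y - A F(x, y) on J, whose center
   is y_0. By the mean value theorem, applied to each f_i separately, a
   difference of its values is (Id - A M)(y - y') with the i-th row of M made
   of partial derivatives of f_i at a point of I * J, so M belongs to the
   interval Jacobian. Every -A c + (Id - A M) w with c in the interval value
   of F and |w| <= r_2 lies in the Krawczyk box, hence has norm at most rho
   r_2. Taking w and -w with the signs of a row of Id - A M bounds its
   absolute row sum by rho, so the Newton map is a rho-contraction; taking w
   = y - y_0 shows that it maps J into the ball of radius rho r_2. Its fixed
   points are the zeros of F(x, _). *)

Require Import Defs.
From HB Require Import structures.
From mathcomp Require Import all_boot all_order all_algebra.
From mathcomp Require mpoly.
(* Without the notations, which clash with those of the analysis library. *)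
Import (canonicals) mpoly.
From mathcomp Require Import boolp classical_sets set_interval reals.
From mathcomp Require Import topology normedtype.
From mathcomp Require polyrcf.
From mathcomp Require Import functions interval_inference sequences.
From mathcomp Require Import ring lra.

Set Implicit Arguments.
Unset Strict Implicit.
Unset Printing Implicit Defensive.

Import Order.TTheory GRing.Theory Num.Theory.
Import numFieldNormedType.Exports.

Local Open Scope classical_set_scope.
Local Open Scope ring_scope.

(* The library has this instance for matrices over a [completeType] only, from
   which the complete normed module structure is not inferred. *)
HB.instance Definition _ (R : realType) m k :=
  Uniform_isComplete.Build 'M[R]_(m, k) (@mx_complete R m k).

(** * Mean value theorem for polynomials along a line *)

Section PolynomialOnLine.
Variables (R : realType) (n : nat) (a v : 'cV[R]_n).

(** Value and directional derivative are recorded together, so that the relation passes to sums and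
    products and the chain rule comes out of the construction of [q]. *)
Definition restricts_to_line (p : mpoly.mpoly n R) (q : {poly R}) : Prop :=
  forall t, q.[t] = peval p (a + t *: v) /\
    q^`().[t] = \sum_(i < n) peval (pderiv i p) (a + t *: v) * v i 0.

Lemma restricts_to_line_const c :
  restricts_to_line (mpoly.mpolyC n c) c%:P.
Proof.
move=> t; rewrite hornerC derivC hornerC /peval mpoly.mevalC; split=> //.
rewrite big1 // => i _.
by rewrite /pderiv mpoly.mderivC mpoly.meval0 mul0r.
Qed.

Lemma restricts_to_line_var k :
  restricts_to_line (mpoly.mpolyX R (mpoly.mnm1 k)) ((a k 0)%:P + v k 0 *: 'X).
Proof.
move=> t; rewrite /peval mpoly.mevalXU !mxE !(derivE, hornerE) mulrC.
split=> //; rewrite (bigD1 k) //= big1 => [|i nik];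
  rewrite /pderiv mpoly.mderivX mpoly.mnm1E.
  (* Subtraction of exponents: the first [mnm1 k] becomes [0 + mnm1 k], so that cancellation leaves
     the exponent 0. *)
  rewrite eqxx scale1r -{1}[mpoly.mnm1 k]mpoly.add0m mpoly.addmK.
  by rewrite mpoly.mpolyX0 mpoly.meval1 mul1r addr0.
by rewrite eq_sym (negbTE nik) scale0r mpoly.meval0 mul0r.
Qed.

Lemma restricts_to_line_add p1 p2 q1 q2 :
  restricts_to_line p1 q1 -> restricts_to_line p2 q2 ->
  restricts_to_line (p1 + p2) (q1 + q2).
Proof.
move=> h1 h2 t; have [e1 d1] := h1 t; have [e2 d2] := h2 t.
rewrite derivD !hornerD e1 e2 d1 d2 /peval mpoly.mevalD; split=> //.
rewrite -big_split; apply: eq_bigr => i _ /=.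
by rewrite /pderiv mpoly.mderivD mpoly.mevalD mulrDl.
Qed.

Lemma restricts_to_line_mul p1 p2 q1 q2 :
  restricts_to_line p1 q1 -> restricts_to_line p2 q2 ->
  restricts_to_line (p1 * p2) (q1 * q2).
Proof.
move=> h1 h2 t; have [e1 d1] := h1 t; have [e2 d2] := h2 t.
rewrite derivM hornerD !hornerM e1 e2 d1 d2 /peval mpoly.mevalM; split=> //.
rewrite mulr_suml mulr_sumr -big_split; apply: eq_bigr => i _ /=.
rewrite /pderiv mpoly.mderivM mpoly.mevalD !mpoly.mevalM mulrDl mulrA.
by rewrite mulrAC.
Qed.

Lemma restricts_to_line_exp p q k :
  restricts_to_line p q -> restricts_to_line (p ^+ k) (q ^+ k).
Proof.
move=> h; elim: k => [|k ih].
  by rewrite !expr0; exact: (restricts_to_line_const 1).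
by rewrite !exprS; exact: restricts_to_line_mul.
Qed.

(** Induction on the terms of [p]; a monomial is a product of powers of variables, each of which
    restricts to a power of an affine polynomial in [t]. *)
Lemma restricts_to_line_exists p : exists q, restricts_to_line p q.
Proof.
elim/mpoly.mpolyind: p => [|c m p _ _ [q hq]].
  by exists 0%:P; rewrite -(mpoly.mpolyC0 n R); exact: restricts_to_line_const.
suff [q' hq'] : exists q', restricts_to_line (mpoly.mpolyX R m) q'.
  exists (c%:P * q' + q); apply: restricts_to_line_add => //.
  rewrite -mpoly.mul_mpolyC; apply: restricts_to_line_mul => //.
  exact: restricts_to_line_const.
rewrite mpoly.mpolyXE_id; elim/big_ind: _ => [|p1 p2 [q1 h1] [q2 h2]|i _].
- by exists 1%:P; exact: (restricts_to_line_const 1).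
- by exists (q1 * q2); exact: restricts_to_line_mul.
exists (((a i 0)%:P + v i 0 *: 'X) ^+ mpoly.fun_of_multinom m i).
by apply: restricts_to_line_exp; exact: restricts_to_line_var.
Qed.

Lemma peval_mvt p : exists2 t, 0 < t < 1 &
  peval p (a + v) - peval p a =
    \sum_(i < n) peval (pderiv i p) (a + t *: v) * v i 0.
Proof.
have [q hq] := restricts_to_line_exists p.
have [t t01 e] := polyrcf.poly_mvt q (ltr01 : (0 : R) < 1).
exists t; first by rewrite in_itv in t01.
move: e; rewrite (hq 1).1 (hq 0).1 (hq t).2.
by rewrite scale1r scale0r addr0 subr0 mulr1.
Qed.

End PolynomialOnLine.

(** * Maximum norm and the inclusion property of interval matrices *)

Lemma mx_norm_leP (R : realDomainType) m k (M : 'M[R]_(m, k)) (e : R) :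
  0 <= e -> `|M| <= e <-> forall i j, `|M i j| <= e.
Proof.
move=> e0; rewrite [`|M|]mx_normrE; split=> [/bigmax_leP[_ h] i j|h].
  exact: (h (i, j)).
(* The maximum starts from 0, which [0 <= e] bounds even when there are no entries. *)
by apply/bigmax_leP; split=> // -[i j].
Qed.

Section IntervalMatrices.
Variable R : realType.

Definition imx_contains m k (P : 'M[set R]_(m, k)) (M : 'M[R]_(m, k)) : Prop :=
  forall i j, P i j (M i j).

Lemma imx_contains_degenerate m k (M : 'M[R]_(m, k)) :
  imx_contains (degenerate M) M.
Proof. by move=> i j; rewrite mxE. Qed.

Lemma imx_contains_add m k (P Q : 'M[set R]_(m, k)) M N :
  imx_contains P M -> imx_contains Q N -> imx_contains (imx_add P Q) (M + N).
Proof.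
by move=> PM QN i j; rewrite !mxE; exists (M i j) => //; exists (N i j).
Qed.

Lemma imx_contains_sub m k (P Q : 'M[set R]_(m, k)) M N :
  imx_contains P M -> imx_contains Q N -> imx_contains (imx_sub P Q) (M - N).
Proof.
by move=> PM QN i j; rewrite !mxE; exists (M i j) => //; exists (N i j).
Qed.

(** Each entry of the interval product lets its factors vary independently, so in general it
    contains more than the products [M *m N]; the inclusion suffices. *)
Lemma imx_contains_mul m k l (P : 'M[set R]_(m, k)) (Q : 'M[set R]_(k, l)) M N :
  imx_contains P M -> imx_contains Q N -> imx_contains (imx_mul P Q) (M *m N).
Proof.
move=> PM QN i j; rewrite !mxE.
apply: (big_rec2 (fun (S : set R) s => S s)) => // h S s _ Ss.
by exists (M i h * N h j); [exists (M i h) => //; exists (N h j)|exists s].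
Qed.

Lemma box_setE m (B : 'cV[set R]_m) x : box_set B x <-> imx_contains B x.
Proof. by split=> [Bx i j|Bx i]; [rewrite ord1|]. Qed.

Lemma centered_boxE m (a : 'cV[R]_m) (r : R) i : 0 < r ->
  centered_box a r i 0 = [set u | `|u - a i 0| <= r].
Proof.
move=> r0; rewrite !mxE; apply/seteqP; split=> [u|u /= ur].
  move=> [? ->] [? [? ->] [s /=]]; rewrite in_itv /= => s1 <- <-.
  by rewrite addrAC subrr add0r normrM gtr0_norm // ger_pMr // ler_norml.
(* The parameter in [-1, 1] is [(u - a i 0) / r]. *)
exists (a i 0) => //; exists (u - a i 0); last by rewrite addrC subrK.
exists r => //; exists ((u - a i 0) / r); last by rewrite mulrC divfK ?gt_eqF.
rewrite /= in_itv /= -ler_norml normrM normfV (gtr0_norm r0).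
by rewrite ler_pdivrMr ?mul1r.
Qed.

Lemma box_set_centered_box m (a x : 'cV[R]_m) (r : R) : 0 < r ->
  box_set (centered_box a r) x <-> `|x - a| <= r.
Proof.
move=> r0; rewrite (mx_norm_leP _ (ltW r0)); split=> [h i j|h i].
  by have := h i; rewrite centered_boxE // ord1 /= !mxE.
by rewrite centered_boxE //=; have := h i 0; rewrite !mxE.
Qed.

Lemma is_box_centered_box m (a : 'cV[R]_m) (r : R) : 0 < r ->
  is_box (centered_box a r).
Proof.
move=> r0 i; exists (a i 0 - r), (a i 0 + r); split; first by lra.
rewrite centered_boxE //; apply/seteqP.
by split=> u /=; rewrite in_itv /= ler_distl.
Qed.

Lemma is_box_degenerate m (a : 'cV[R]_m) : is_box (degenerate a).
Proof. by move=> i; exists (a i 0), (a i 0); rewrite mxE set_itv1. Qed.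

Lemma box_set_scaled_centered_box m (a x : 'cV[R]_m) (r rho : R) :
    0 < r -> 0 <= rho ->
  box_set (imx_scale rho (imx_sub (centered_box a r) (degenerate a))) x ->
  `|x| <= rho * r.
Proof.
move=> r0 rho0 h; apply/(mx_norm_leP _ (mulr_ge0 rho0 (ltW r0))) => i j.
have := h i; rewrite ord1 2!mxE => -[? ->] [? [u + [? + <-] <-]].
rewrite centered_boxE // mxE => /= ur ->.
by rewrite normrM ger0_norm // ler_wpM2l.
Qed.

End IntervalMatrices.

(** * Splitting coordinates into the first [d] and the last [n - d] *)

Section Coordinates.
Variables (n d : nat) (le_dn : (d <= n)%N).

Lemma join_coords_first T (x : 'cV[T]_d) (y : 'cV[T]_(n - d)) i :
  join_coords le_dn x y (cast_ord (subnKC le_dn) (lshift (n - d) i)) 0 = x i 0.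
Proof. by rewrite castmxE cast_ordK cast_ord_id col_mxEu. Qed.

Lemma join_coords_last T (x : 'cV[T]_d) (y : 'cV[T]_(n - d)) j :
  join_coords le_dn x y (last_index le_dn j) 0 = y j 0.
Proof. by rewrite castmxE cast_ordK cast_ord_id col_mxEd. Qed.

Lemma split_coordsP (Q : 'I_n -> Prop) :
    (forall i, Q (cast_ord (subnKC le_dn) (lshift (n - d) i))) ->
    (forall j, Q (last_index le_dn j)) ->
  forall i, Q i.
Proof.
move=> hf hl i; rewrite -(cast_ordKV (subnKC le_dn) i).
by case: (split_ordP (cast_ord (esym (subnKC le_dn)) i)) => j ->;
  [exact: hf|exact: hl].
Qed.

Lemma sum_split_coords (V : nmodType) (E : 'I_n -> V) :
  \sum_(i < n) E i =
  \sum_(i < d) E (cast_ord (subnKC le_dn) (lshift (n - d) i)) +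
  \sum_(j < n - d) E (last_index le_dn j).
Proof.
rewrite (reindex (cast_ord (subnKC le_dn))) /= ?big_split_ord //.
by exists (cast_ord (esym (subnKC le_dn))) => i _;
  rewrite ?cast_ordK ?cast_ordKV.
Qed.

Lemma is_box_join_coords (R : realType) (B : 'cV[set R]_d) (C : 'cV_(n - d)) :
  is_box B -> is_box C -> is_box (join_coords le_dn B C).
Proof.
move=> hB hC; apply: split_coordsP => i.
  by rewrite join_coords_first.
by rewrite join_coords_last.
Qed.

Lemma box_set_join_coords (R : realType) (B : 'cV[set R]_d) (C : 'cV_(n - d))
    x y :
  box_set B x -> box_set C y ->
  box_set (join_coords le_dn B C) (join_coords le_dn x y).
Proof.
move=> Bx Cy; apply: split_coordsP => i.
  by rewrite !join_coords_first.
by rewrite !join_coords_last.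
Qed.

End Coordinates.

(** * Consequences of the Krawczyk inclusion *)

Section Krawczyk.
Variables (R : realType) (n d : nat) (le_dn : (d <= n)%N).
Variables (F : 'I_(n - d) -> mpoly.mpoly n R) (zhat : 'cV[R]_n) (r1 r2 : R).
Hypotheses (r1_gt0 : 0 < r1) (r2_gt0 : 0 < r2).
Variable A : 'M[R]_(n - d).
Variables (sF : 'I_(n - d) -> 'cV[set R]_n -> set R)
  (sJ : 'I_(n - d) -> 'I_(n - d) -> 'cV[set R]_n -> set R).
Hypotheses (extF : system_extension F sF)
  (extJ : jacobian_extension le_dn F sJ).
Variable rho : R.
Hypotheses (rho_gt0 : 0 < rho) (rho_lt1 : rho < 1).

Let x0 := first_coords le_dn zhat.
Let y0 := last_coords le_dn zhat.
Let I := centered_box x0 r1.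
Let J := centered_box y0 r2.

Hypothesis contracting : box_set (krawczyk le_dn sF sJ zhat r1 r2 A) `<=`
  box_set (imx_scale rho (imx_sub J (degenerate y0))).

(** The entries are chosen independently, so [M] need not be the Jacobian block at any single
    point. *)
Let jacobian_value (M : 'M[R]_(n - d)) : Prop :=
  forall i j, sJ i j (join_coords le_dn I J) (M i j).

Let system_value (x : 'cV[R]_d) (y : 'cV[R]_(n - d)) : 'cV[R]_(n - d) :=
  \col_i peval (F i) (join_coords le_dn x y).

Lemma system_value_mvt x y y' :
    box_set I x -> `|y - y0| <= r2 -> `|y' - y0| <= r2 ->
  exists2 M, jacobian_value M &
    system_value x y - system_value x y' = M *m (y - y').
Proof.
move=> Ix Jy Jy'; pose a := join_coords le_dn x y'.
(* The direction vanishes in the first [d] coordinates, so only the last [n - d] partial derivatives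
   contribute. *)
pose v := join_coords le_dn 0 (y - y').
have av t : a + t *: v = join_coords le_dn x (y' + t *: (y - y')).
  apply/matrixP => i j; rewrite ord1; elim/(split_coordsP (le_dn := le_dn)): i.
    by move=> i; rewrite !mxE !join_coords_first mxE mulr0 addr0.
  by move=> i; rewrite !mxE !join_coords_last !mxE.
have /choice[t ht] i : exists t, 0 < t < 1 /\
    peval (F i) (a + v) - peval (F i) a =
    \sum_(k < n) peval (pderiv k (F i)) (a + t *: v) * v k 0.
  by have [t t01 e] := peval_mvt a v (F i); exists t.
exists (\matrix_(i, j)
    peval (pderiv (last_index le_dn j) (F i)) (a + t i *: v)).
  move=> i j; rewrite mxE; have [/andP[t0 t1] _] := ht i.
  have [|_] := extJ i j (B := join_coords le_dn I J).
    by apply: is_box_join_coords; exact: is_box_centered_box.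
  apply; exists (a + t i *: v) => //; rewrite av.
  apply: box_set_join_coords => //; apply/box_set_centered_box => //.
  (* The intermediate point stays in [J] by convexity of the ball. *)
  have -> : y' + t i *: (y - y') - y0 =
      (1 - t i) *: (y' - y0) + t i *: (y - y0).
    by apply/matrixP => k l; rewrite !mxE; ring.
  have s0 : 0 <= 1 - t i by rewrite subr_ge0 ltW.
  rewrite (le_trans (ler_normD _ _)) // !normrZ (gtr0_norm t0) (ger0_norm s0).
  rewrite [leRHS](_ : r2 = (1 - t i) * r2 + t i * r2); last by ring.
  by rewrite lerD // ler_wpM2l // ltW.
apply/matrixP => i j; rewrite ord1 !mxE; have [_] := ht i.
rewrite -{1}[v]scale1r av scale1r [y' + _]addrC subrK => ->.
rewrite (sum_split_coords le_dn) big1 ?add0r => [|k _]; last first.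
  by rewrite join_coords_first mxE mulr0.
by apply: eq_bigr => k _; rewrite join_coords_last [in RHS]mxE.
Qed.

(** By the inclusion property the vector lies in the Krawczyk box. [M] and [w] are unrelated here,
    which leaves [w] free to be chosen after [M]. *)
Lemma krawczyk_value x M w : box_set I x -> jacobian_value M -> `|w| <= r2 ->
  `|- (A *m system_value x y0) + (1%:M - A *m M) *m w| <= rho * r2.
Proof.
move=> Ix JM w2; apply/(box_set_scaled_centered_box (a := y0)) => //.
  exact: ltW.
apply: contracting; apply/box_setE; rewrite -mulNmx.
apply: imx_contains_add; apply: imx_contains_mul.
- exact: imx_contains_degenerate.
- move=> i j; rewrite !mxE.
  have [|_] := extF i (B := join_coords le_dn I (degenerate y0)).
    apply: is_box_join_coords; first exact: is_box_centered_box.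
    exact: is_box_degenerate.
  apply; exists (join_coords le_dn x y0) => //.
  apply: box_set_join_coords => //.
  exact/box_setE/imx_contains_degenerate.
- apply: imx_contains_sub; first exact: imx_contains_degenerate.
  apply: imx_contains_mul; first exact: imx_contains_degenerate.
  by move=> i j; rewrite mxE; exact: JM.
(* Written as [w + y0 - y0], the vector is a point of [J] minus the center. *)
rewrite -[w](addrK y0); apply: imx_contains_sub.
  by apply/box_setE/box_set_centered_box => //; rewrite addrK.
exact: imx_contains_degenerate.
Qed.

Lemma krawczyk_row_sum x M i : box_set I x -> jacobian_value M ->
  \sum_(h < n - d) `|(1%:M - A *m M) i h| <= rho.
Proof.
move=> Ix JM; set B := 1%:M - A *m M.
pose w : 'cV[R]_(n - d) := \col_h (r2 * Num.sg (B i h)).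
have w2 : `|w| <= r2.
  (* The sign of a zero entry is 0, so the entries of [w] have absolute value [r2] or 0. *)
  apply/(mx_norm_leP _ (ltW r2_gt0)) => h j; rewrite mxE normrM normr_sg.
  by rewrite gtr0_norm // ger_pMr // lern1 leq_b1.
have e : (B *m w) i 0 = r2 * \sum_h `|B i h|.
  rewrite mxE mulr_sumr; apply: eq_bigr => h _.
  by rewrite [w h 0]mxE normrEsg; ring.
have bound0 : 0 <= rho * r2 by rewrite mulr_ge0 ?ltW.
have /(mx_norm_leP _ bound0)/(_ i 0) := krawczyk_value Ix JM w2.
have w2N : `|- w| <= r2 by rewrite normrN.
have /(mx_norm_leP _ bound0)/(_ i 0) := krawczyk_value Ix JM w2N.
have addE (u u' : 'cV[R]_(n - d)) : (u + u') i 0 = u i 0 + u' i 0 :> R.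
  by rewrite mxE.
have oppE (u : 'cV[R]_(n - d)) : (- u) i 0 = - u i 0 :> R by rewrite mxE.
rewrite -/B !addE mulmxN !oppE e.
rewrite !ler_norml => /andP[h1 h2] /andP[h3 h4].
(* Subtracting the lower bound for [- w] from the upper bound for [w] cancels the term in
   [system_value x y0] and leaves twice the row sum times [r2], at most [2 * rho * r2]. *)
by rewrite -(ler_pM2l r2_gt0) [r2 * rho]mulrC; lra.
Qed.

(** * The Newton map as a contraction of [J] *)

Let newton (x : 'cV[R]_d) (y : 'cV[R]_(n - d)) : 'cV[R]_(n - d) :=
  y - A *m system_value x y.

Lemma newton_mvt x y y' :
    box_set I x -> `|y - y0| <= r2 -> `|y' - y0| <= r2 ->
  exists2 M, jacobian_value M &
    newton x y - newton x y' = (1%:M - A *m M) *m (y - y').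
Proof.
move=> Ix Jy Jy'; have [M JM e] := system_value_mvt Ix Jy Jy'; exists M => //.
by rewrite mulmxBl mul1mx -mulmxA -e mulmxBr /newton !opprD addrACA.
Qed.

(** For the maximum norm a matrix expands by at most its largest absolute row sum. [M] changes with
    [y] and [y'], but the bound [rho] does not. *)
Lemma newton_lipschitz x y y' :
    box_set I x -> `|y - y0| <= r2 -> `|y' - y0| <= r2 ->
  `|newton x y - newton x y'| <= rho * `|y - y'|.
Proof.
move=> Ix Jy Jy'; have [M JM ->] := newton_mvt Ix Jy Jy'.
have b0 : 0 <= rho * `|y - y'| by rewrite mulr_ge0 // ltW.
apply/(mx_norm_leP _ b0) => i j; rewrite mxE (le_trans (ler_norm_sum _ _ _)) //.
apply: (@le_trans _ _ (\sum_h `|(1%:M - A *m M) i h| * `|y - y'|)).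
  apply: ler_sum => h _; rewrite normrM ler_wpM2l //.
  exact: (mx_norm_leP _ (normr_ge0 _)).1.
by rewrite -mulr_suml ler_wpM2r //; exact: krawczyk_row_sum JM.
Qed.

(** Expanding around the center turns [newton x y - y0] into a vector of the Krawczyk box, with
    [w = y - y0]. *)
Lemma newton_stable x y : box_set I x -> `|y - y0| <= r2 ->
  `|newton x y - y0| <= rho * r2.
Proof.
move=> Ix Jy; have Jy0 : `|y0 - y0| <= r2 by rewrite subrr normr0 ltW.
have [M JM e] := newton_mvt Ix Jy Jy0.
have -> : newton x y - y0 =
    - (A *m system_value x y0) + (1%:M - A *m M) *m (y - y0).
  by rewrite -e [newton x y0]/newton opprB addrCA addKr.
exact: krawczyk_value.
Qed.

Hypothesis A_unit : A \in unitmx.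

(** A fixed point satisfies [A *m system_value x y = 0], and the invertible [A] cancels. *)
Lemma newton_fixed x y : y = newton x y <->
  forall i, peval (F i) (join_coords le_dn x y) = 0.
Proof.
split=> [/eqP|F0].
  rewrite eq_sym -subr_eq0 addrAC subrr add0r oppr_eq0 => /eqP AF i.
  have /matrixP/(_ i 0) : system_value x y = 0.
    by rewrite -(mulKmx A_unit (system_value x y)) AF mulmx0.
  by rewrite !mxE.
have s0 : system_value x y = 0 by apply/matrixP => i j; rewrite !mxE F0.
by rewrite /newton s0 mulmx0 subr0.
Qed.

Let ball0 : set 'cV[R]_(n - d) := [set y | `|y - y0| <= r2].

Lemma krawczyk_zero x : box_set I x ->
  exists ystar : 'cV[R]_(n - d),
      unique (fun y => box_set J y /\
                forall i, peval (F i) (join_coords le_dn x y) = 0) ystar /\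
      `|ystar - y0| <= r2 * rho.
Proof.
move=> Ix.
have stable : {homo newton x : y / ball0 y >-> ball0 y}.
  move=> y By.
  (* The image has radius [rho * r2], at most [r2] since [rho < 1]. *)
  by rewrite /ball0 /= (le_trans (newton_stable Ix By)) // ler_piMl ?ltW.
have ctr : is_contraction (mkfun_fun stable).
  exists (NngNum (ltW rho_gt0)); split => //= -[y y'] [By By'] /=.
  exact: newton_lipschitz.
have closed0 : closed ball0.
  have -> : ball0 = closed_ball_ Num.norm y0 r2.
    by apply/seteqP; split=> y; rewrite /ball0 /closed_ball_ /= distrC.
  exact: closed_closed_ball_.
(* The Banach theorem asks for a nonempty closed set; the center [y0] is a point of it. *)
have [|y By ye] := banach_fixed_point ctr closed0.
  by exists y0; rewrite /ball0 /= subrr normr0 ltW.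
exists y; split; last first.
  (* Being its own image, the fixed point inherits the sharper radius of the image. *)
  by rewrite ye mulrC; exact: newton_stable.
split=> [|y' [Jy' /newton_fixed y'e]].
  by split; [exact/box_set_centered_box|exact/newton_fixed].
apply: (contraction_fixpoint_unique ctr) => //.
exact/box_set_centered_box.
Qed.

End Krawczyk.

Theorem theorem2p1 (R : realType) (n d : nat)
  (d_ge1 : (1 <= d)%N) (d_lt_n : (d < n)%N)
  (F : 'I_(n - d) -> mpoly.mpoly n R)
  (smoothX : smooth_pure_variety (zero_locus (range F)) d)
  (zhat : 'cV[R]_n) (r1 r2 : R) (r1_gt0 : 0 < r1) (r2_gt0 : 0 < r2)
  (A : 'M[R]_(n - d)) (A_unit : A \in unitmx)
  (sF : 'I_(n - d) -> 'cV[set R]_n -> set R)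
  (sJ : 'I_(n - d) -> 'I_(n - d) -> 'cV[set R]_n -> set R)
  (extF : system_extension F sF)
  (extJ : jacobian_extension (ltnW d_lt_n) F sJ)
  (rho : R) (rho_gt0 : 0 < rho) (rho_lt1 : rho < 1) :
  let le_dn := ltnW d_lt_n in
  let y0 := last_coords le_dn zhat in
  let I := centered_box (first_coords le_dn zhat) r1 in
  let J := centered_box y0 r2 in
  box_set (krawczyk le_dn sF sJ zhat r1 r2 A) `<=`
    box_set (imx_scale rho (imx_sub J (degenerate y0))) ->
  forall xhat, box_set I xhat ->
    exists ystar : 'cV[R]_(n - d),
      unique (fun y => box_set J y /\
                forall i, peval (F i) (join_coords le_dn xhat y) = 0) ystar /\
      `|ystar - y0| <= r2 * rho.
Proof.
move=> le_dn y0 I J contracting xhat.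
exact: krawczyk_zero contracting A_unit _.
Qed.
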